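(* For any collection of $2^n\times 2^n$ Hermitian observables $O_1,\dots,O_M$ with $\|O_i\|_\infty\le1$ and any $\epsilon>0$, there is a learning algorithm without quantum memory that uses $$T\le\mathcal{O}\!\left(\frac{\min(M\log M,\ 2^n\log M)}{\epsilon^2}\right)$$ copies of an unknown $n$-qubit state $\rho$ and, with high (constant, e.g. at least $0.99$) probability, outputs estimates of $\mathrm{Tr}(O_x\rho)$ within additive error $\epsilon$ simultaneously for all $x=1,\dots,M$.
   Context: $\|\cdot\|_\infty$ is the operator norm. An $n$-qubit state is a $2^n\times 2^n$ positive semidefinite complex matrix of trace one. A learning algorithm without quantum memory using $T$ copies of an unknown $n$-qubit state $\rho$ proceeds in $T$ rounds: in each round it receives a fresh copy of $\rho$, chooses a POVM $\{F_s\}_s$ on $n$ qubits (positive semidefinite matrices with $\sum_s F_s=I$), where the choice may depend arbitrarily on all previously observed classical outcomes (and on internal classical randomness), and observes outcome $s$ with probability $\mathrm{Tr}(F_s\rho)$; no quantum state is retained between rounds. Its final output is an arbitrary function of the observed classical outcomes.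
   Formalization: The bound is proved with log(M+1) in place of log M: for M ≥ 2 these agree up to a constant, while for M = 1 the printed bound would force T = 0, which is impossible (e.g. O = Z on one qubit, ε = 1/2). *)

(* Defs.v *)
From HB Require Import structures.
From mathcomp Require Import all_boot all_order all_algebra.
From mathcomp Require Import reals exp.
From mathcomp Require Import complex.

Set Implicit Arguments.
Unset Strict Implicit.
Unset Printing Implicit Defensive.

Import Order.TTheory GRing.Theory Num.Theory.
Local Open Scope ring_scope.
Local Open Scope complex_scope.

Definition adjmx (C : numClosedFieldType) m p (A : 'M[C]_(m, p)) : 'M[C]_(p, m) :=
  map_mx Num.conj (A ^T).

Definition is_hermitian (C : numClosedFieldType) d (A : 'M[C]_d) : Prop :=
  adjmx A = A.

Definition psd (C : numClosedFieldType) d (A : 'M[C]_d) : Prop :=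
  is_hermitian A /\ forall v : 'cV[C]_d, 0 <= (adjmx v *m A *m v) 0 0.

Definition opnorm_le1 (C : numClosedFieldType) d (A : 'M[C]_d) : Prop :=
  forall v : 'cV[C]_d, (adjmx (A *m v) *m (A *m v)) 0 0 <= (adjmx v *m v) 0 0.

Definition qstate (R : realType) (n : nat) (rho : 'M[R[i]]_(2 ^ n)) : Prop :=
  psd rho /\ \tr rho = 1.

Definition is_povm (R : realType) (n : nat) (S : finType)
  (F : S -> 'M[R[i]]_(2 ^ n)) : Prop :=
  (forall s, psd (F s)) /\ \sum_(s : S) F s = 1%:M.

(* A learning algorithm without quantum memory, using T copies and estimating
   M real numbers.  Outcomes of every round lie in a finite set S.  In round t
   (0-based) the POVM [lpovm h] is chosen as an arbitrary function of the
   history h (the t previously observed outcomes); the final output is an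
   arbitrary function of all T outcomes.  Internal classical randomness
   (with finitely many values) is absorbed into the POVMs. *)
Record nomem_learner (R : realType) (n M : nat) := NoMemLearner {
  lT : nat;
  lS : finType;
  lpovm : seq lS -> lS -> 'M[R[i]]_(2 ^ n);
  lout : lT.-tuple lS -> 'I_M -> R;
  lpovm_ok : forall h : seq lS, is_povm (lpovm h)
}.

Definition hist_prob (R : realType) n M (L : nomem_learner R n M)
  (rho : 'M[R[i]]_(2 ^ n)) (h : (lT L).-tuple (lS L)) : R[i] :=
  \prod_(t < lT L) \tr (@lpovm _ _ _ L (take t h) (tnth h t) *m rho).

Definition all_within (R : realType) n M (O : 'I_M -> 'M[R[i]]_(2 ^ n))
  (rho : 'M[R[i]]_(2 ^ n)) (eps : R) (est : 'I_M -> R) : bool :=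
  [forall x : 'I_M, `|(est x)%:C - \tr (O x *m rho)| <= eps%:C].

Definition success_prob (R : realType) n M (L : nomem_learner R n M)
  (O : 'I_M -> 'M[R[i]]_(2 ^ n)) (eps : R) (rho : 'M[R[i]]_(2 ^ n)) : R[i] :=
  \sum_(h : (lT L).-tuple (lS L))
     @hist_prob _ _ _ L rho h * (if all_within O rho eps (@lout _ _ _ L h) then 1 else 0).

(* Main.v *)
(** Every round measures one fixed POVM [F], and [Tr (O_x rho)] is estimated by
the empirical mean of a real function [f x] of the outcomes such that
[\sum_s f x s *: F s = O_x].  If [|f x| <= 2 D] and the second moment of [f x]
is at most [4 D] in every state, then a Bernstein-type exponential bound and a
union bound over [x] show that [O(D log M / eps^2)] rounds suffice.

For [D = M], measure the two-outcome POVM [(1 +- O_x) / 2] for a uniformly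
random [x], and let [f x] be [+- M] on the outcomes belonging to [x] and [0] on
the others.

For [D = d = 2^n], take the outcomes [(k, l, phi)] with [phi] a fourth root of
unity, the POVM elements [(8 d)^-1 (e_k + phi e_l)(e_k + phi e_l)^*], and
[f x (k, l, phi) = 2 d Re (O_x k l phi)].  Averaging over [phi] keeps only the
entries [(k, l)] and [(l, k)], so this is unbiased; and as the rows of [O_x]
have norm at most [1], the second moment is at most
[2 d \sum_(k, l) |O_x k l|^2 (rho k k + rho l l) <= 4 d]. *)

Require Import Defs.
From HB Require Import structures.
From mathcomp Require Import all_boot all_order all_algebra.
From mathcomp Require Import reals sequences exp.
From mathcomp Require Import complex.
From mathcomp Require Import ring lra.

Import Order.TTheory GRing.Theory Num.Theory.
Local Open Scope ring_scope.

(** * Adjoints and positive semidefinite matrices *)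

Section PositiveSemidefinite.
Variables (C : numClosedFieldType).

Lemma adjmxM m n p (A : 'M[C]_(m, n)) (B : 'M[C]_(n, p)) :
  adjmx (A *m B) = adjmx B *m adjmx A.
Proof. by rewrite /adjmx trmx_mul map_mxM. Qed.

Lemma adjmxD m n (A B : 'M[C]_(m, n)) : adjmx (A + B) = adjmx A + adjmx B.
Proof. by apply/matrixP => i j; rewrite !mxE rmorphD. Qed.

Lemma adjmxZ m n (a : C) (A : 'M[C]_(m, n)) :
  adjmx (a *: A) = Num.conj a *: adjmx A.
Proof. by apply/matrixP => i j; rewrite !mxE rmorphM. Qed.

Lemma adjmxK m n (A : 'M[C]_(m, n)) : adjmx (adjmx A) = A.
Proof. by apply/matrixP => i j; rewrite !mxE conjCK. Qed.

Lemma adjmx1 n : adjmx (1%:M : 'M[C]_n) = 1%:M.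
Proof. by rewrite /adjmx trmx1 map_mx1. Qed.

Lemma adjmx_delta m n (i : 'I_m) (j : 'I_n) :
  adjmx (delta_mx i j : 'M[C]_(m, n)) = delta_mx j i.
Proof. by rewrite /adjmx trmx_delta map_delta_mx. Qed.

Lemma adjmx_mul_ge0 n (u : 'cV[C]_n) : 0 <= (adjmx u *m u) 0 0.
Proof. by rewrite mxE sumr_ge0 // => i _; rewrite !mxE mulrC mul_conjC_ge0. Qed.

Lemma psdZ n (a : C) (A : 'M[C]_n) : 0 <= a -> psd A -> psd (a *: A).
Proof.
move=> a0 [hA pA]; split; first by rewrite /is_hermitian adjmxZ hA (CrealP (ger0_real a0)).
by move=> v; rewrite -scalemxAr -scalemxAl mxE mulr_ge0.
Qed.

Lemma psd_rank1 n (u : 'cV[C]_n) : psd (u *m adjmx u).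
Proof.
split; first by rewrite /is_hermitian adjmxM adjmxK.
move=> v; rewrite mulmxA -mulmxA -[X in X *m _]adjmxK adjmxM adjmxK.
exact: adjmx_mul_ge0.
Qed.

Lemma psd_spectral n (A : 'M[C]_n) : psd A ->
  exists (P : 'M[C]_n) (D : 'rV[C]_n),
    (forall i, 0 <= D 0 i) /\ A = adjmx P *m diag_mx D *m P.
Proof.
move=> [hA pA].
have nA : A \is spectral.normalmx.
  by apply/spectral.normalmxP; change (A *m adjmx A = adjmx A *m A); rewrite hA.
have uP := spectral.spectral_unitarymx A.
have := spectral.orthomx_spectralP nA.
rewrite (spectral.invmx_unitary uP).
set P := spectral.spectralmx A in uP *; set D := spectral.spectral_diag A.
move=> eA0; have eA : A = adjmx P *m diag_mx D *m P := eA0.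
exists P, D; split=> // i.
have PP : P *m adjmx P = 1%:M by apply/spectral.unitarymxP.
(* The eigenvalue [D 0 i] is the quadratic form of [A] at the [i]-th column of [adjmx P]. *)
have := pA (adjmx P *m delta_mx i 0).
rewrite eA adjmxM adjmxK !mulmxA -(mulmxA _ P) PP mulmx1 -(mulmxA _ P) PP mulmx1.
rewrite adjmx_delta -rowE row_diag_mx -scalemxAl mul_delta_mx.
by rewrite !mxE !eqxx mulr1.
Qed.

(** Diagonalising [A] and using cyclicity, the trace becomes the sum of the eigenvalues [D 0 i]
    times the diagonal entries of [P *m B *m adjmx P], and all these factors are nonnegative. *)
Lemma psd_mxtrace_mul_ge0 n (A B : 'M[C]_n) : psd A -> psd B -> 0 <= \tr (A *m B).
Proof.
move=> /psd_spectral[P [D [D0 ->]]] [hB pB].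
rewrite -!mulmxA mxtrace_mulC -!mulmxA mul_diag_mx.
rewrite /mxtrace sumr_ge0 // => i _; rewrite mxE mulr_ge0 //.
have := pB (adjmx P *m delta_mx i 0).
rewrite adjmxM adjmxK adjmx_delta !mulmxA -!(mulmxA (delta_mx _ _)) -rowE -colE.
by rewrite [row _ _ _ _]mxE [col _ _ _ _]mxE.
Qed.

(** As [s] squares to 1, twice the quadratic form at [v] is |v + s A v|^2 + (|v|^2 - |A v|^2). *)
Lemma opnorm_le1_psd n (A : 'M[C]_n) (s : C) :
  is_hermitian A -> opnorm_le1 A -> s \is Num.real -> s ^+ 2 = 1 ->
  psd (1%:M + s *: A).
Proof.
move=> hA oA /CrealP sR s2; split.
  by rewrite /is_hermitian adjmxD adjmx1 adjmxZ sR hA.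
move=> v.
have := adjmx_mul_ge0 n (v + s *: (A *m v)); have := oA v.
rewrite adjmxD adjmxZ sR !mulmxDl !mulmxDr adjmxM hA.
rewrite -!scalemxAl -!scalemxAr mulmx1 !mulmxDl -scalemxAl scalerA -!mulmxA -expr2 s2.
move: (adjmx v *m (A *m (A *m v))) (adjmx v *m v) (adjmx v *m (A *m v)) => X Y Z.
rewrite !mxE => XY h; rewrite -(pmulr_rge0 _ (ltr0n C 2)).
apply: le_trans h _; rewrite -subr_ge0.
have -> : 2 * (Y 0 0 + s * Z 0 0) -
    (Y 0 0 + s * Z 0 0 + (s * Z 0 0 + 1 * X 0 0)) = Y 0 0 - X 0 0 by ring.
by rewrite subr_ge0.
Qed.

End PositiveSemidefinite.

(** * The measurement of pairs of basis vectors with a phase *)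

Section PhasePair.
Variables (C : numClosedFieldType) (d : nat).
Local Notation phase a := ('i ^+ nat_of_ord a : C).

Lemma phase_norm (a : 'I_4) : phase a * (phase a)^* = 1.
Proof. by rewrite -normCK normrX normCi !expr1n. Qed.

(** Over the fourth roots of unity both phi and phi^2 sum to zero, so only the products phi phi^* =
    1 survive. *)
Lemma phase_sum_weighted (X Y Z : 'M[C]_d) (u w : C) :
  \sum_(a < 4) (u * phase a + w * (phase a)^* ) *:
     (X + (phase a)^* *: Y + phase a *: Z) = 4 *: (u *: Y + w *: Z).
Proof.
rewrite !big_ord_recl big_ord0 /= addr0 /bump /= !rmorphXn /= !conjCi.
have i2 : 'i ^+ 2 = -1 :> C := sqrCi C.
by apply/matrixP => i j; rewrite !mxE; ring: i2.
Qed.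

Lemma phase_sum (X Y Z : 'M[C]_d) :
  \sum_(a < 4) (X + (phase a)^* *: Y + phase a *: Z) = 4 *: X.
Proof.
rewrite !big_ord_recl big_ord0 /= addr0 /bump /= !rmorphXn /= !conjCi.
have i2 : 'i ^+ 2 = -1 :> C := sqrCi C.
by apply/matrixP => i j; rewrite !mxE; ring: i2.
Qed.

(** Pairs are ordered and [k = l] is allowed, so every basis vector occurs [2 d] times for each of
    the 4 phases; this is the source of the factor [8 d]. *)
Definition pair_povm (s : 'I_d * 'I_d * 'I_4) : 'M[C]_d :=
  let u : 'cV[C]_d := delta_mx s.1.1 0 + phase s.2 *: delta_mx s.1.2 0 in
  (8 * d%:R)^-1 *: (u *m adjmx u).

Lemma pair_povmE k l a : pair_povm (k, l, a) = (8 * d%:R)^-1 *: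
  ((delta_mx k k + delta_mx l l) + (phase a)^* *: delta_mx k l + phase a *: delta_mx l k).
Proof.
rewrite /pair_povm /=; congr (_ *: _).
rewrite adjmxD adjmxZ !adjmx_delta mulmxDl !mulmxDr -!scalemxAl -!scalemxAr.
rewrite !mul_delta_mx scalerA phase_norm scale1r.
by rewrite -!addrA; congr (_ + _); rewrite [LHS]addrA [LHS]addrC.
Qed.

Lemma pair_sum (V : nmodType) (G : 'I_d * 'I_d * 'I_4 -> V) :
  \sum_s G s = \sum_k \sum_l \sum_a G (k, l, a).
Proof.
rewrite pair_bigA /= (pair_bigA _ (fun p a => G (p.1, p.2, a))) /=.
by apply: eq_bigr => -[[k l] a].
Qed.

Hypothesis d_gt0 : (0 < d)%N.
Let dC : d%:R != 0 :> C. Proof. by rewrite pnatr_eq0 -lt0n. Qed.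

Lemma pair_povm_sum_phase k l :
  \sum_a pair_povm (k, l, a) = (2 * d%:R)^-1 *: (delta_mx k k + delta_mx l l).
Proof.
under eq_bigr do rewrite pair_povmE.
rewrite -scaler_sumr phase_sum scalerA; congr (_ *: _).
by field.
Qed.

Lemma pair_povm_psd s : psd (pair_povm s).
Proof. by apply: psdZ (psd_rank1 _ _ _); rewrite invr_ge0 mulr_ge0. Qed.

Lemma pair_povm_sum : \sum_s pair_povm s = 1%:M.
Proof.
rewrite pair_sum; under eq_bigr do under eq_bigr do rewrite pair_povm_sum_phase.
under eq_bigr do rewrite -scaler_sumr big_split /= sumr_const card_ord -mx1_sum_delta.
rewrite -scaler_sumr big_split /= sumr_const card_ord sumrMnl -mx1_sum_delta.
rewrite -mulr2n -!scaler_nat !scalerA -[RHS]scale1r; congr (_ *: _).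
by field.
Qed.

Lemma pair_povm_unbiased (A : 'M[C]_d) :
  \sum_k \sum_l \sum_a (d%:R * (A k l * phase a + A l k * (phase a)^* )) *: pair_povm (k, l, a) = A.
Proof.
rewrite [RHS]matrix_sum_delta.
(* Each pair yields half of two entries; the second halves are the first ones with [k] and [l]
   exchanged. *)
transitivity (\sum_k \sum_l (2^-1 *: (A k l *: delta_mx k l) + 2^-1 *: (A l k *: delta_mx l k))).
  apply: eq_bigr => k _; apply: eq_bigr => l _.
  under eq_bigr do rewrite pair_povmE scalerA mulrAC -scalerA.
  rewrite -scaler_sumr phase_sum_weighted -scalerDr scalerA; congr (_ *: _).
  by field.
under eq_bigr do rewrite big_split /=.
rewrite big_split /= [X in _ + X]exchange_big /=.
under eq_bigr do rewrite -scaler_sumr.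
by rewrite -scaler_sumr -scalerDl (_ : 2^-1 + 2^-1 = 1) ?scale1r //; field.
Qed.

Lemma opnorm_le1_col (A : 'M[C]_d) k : opnorm_le1 A -> \sum_l `|A l k| ^+ 2 <= 1.
Proof.
move=> /(_ (delta_mx k 0)); rewrite -colE adjmx_delta mul_delta_mx !mxE !eqxx /=.
by congr (_ <= _); apply: eq_bigr => l _; rewrite !mxE normCK mulrC.
Qed.

Lemma hermitian_entry (A : 'M[C]_d) k l : is_hermitian A -> A l k = (A k l)^*.
Proof. by move=> hA; rewrite -{1}hA !mxE. Qed.

(** The squared quantity is a majorant of the estimator that is free of the phase. Summing out the
    phases first leaves each diagonal entry of [rho] multiplied by the squared norms of a row and a
    column of [A]. *)
Lemma pair_povm_moment (A rho : 'M[C]_d) :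
  is_hermitian A -> opnorm_le1 A -> psd rho -> \tr rho = 1 ->
  \sum_k \sum_l \sum_a (2 * d%:R * `|A k l|) ^+ 2 * \tr (pair_povm (k, l, a) *m rho)
    <= 4 * d%:R.
Proof.
move=> hA oA rp r1.
pose q k := \tr (delta_mx k k *m rho).
have q0 k : 0 <= q k.
  rewrite psd_mxtrace_mul_ge0 // -(mul_delta_mx (0 : 'I_1)) -(adjmx_delta _ _ _ k 0).
  exact: psd_rank1.
have q1 : \sum_k q k = 1.
  by rewrite -raddf_sum /= -mulmx_suml -mx1_sum_delta mul1mx.
have colA k : \sum_l `|A l k| ^+ 2 <= 1 by exact: opnorm_le1_col.
have rowA k : \sum_l `|A k l| ^+ 2 <= 1.
  by under eq_bigr do rewrite (hermitian_entry _ _ _ hA) norm_conjC.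
have -> : \sum_k \sum_l \sum_a (2 * d%:R * `|A k l|) ^+ 2 * \tr (pair_povm (k, l, a) *m rho)
  = 2 * d%:R * (\sum_k q k * (\sum_l `|A k l| ^+ 2) + \sum_l q l * (\sum_k `|A k l| ^+ 2)).
  under [X in _ + X]eq_bigr do rewrite mulr_sumr.
  rewrite [X in _ + X]exchange_big /= -big_split /= mulr_sumr; apply: eq_bigr => k _.
  rewrite mulr_sumr -big_split /= mulr_sumr; apply: eq_bigr => l _.
  rewrite -mulr_sumr -raddf_sum /= -mulmx_suml pair_povm_sum_phase.
  rewrite -scalemxAl mxtraceZ mulmxDl mxtraceD -/(q k) -/(q l).
  by field.
have -> : 4 * d%:R = 2 * d%:R * (\sum_k q k + \sum_k q k) by rewrite q1; ring.
rewrite ler_wpM2l ?mulr_ge0 // lerD // ler_sum // => k _; exact: ler_piMr.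
Qed.

End PhasePair.

Local Open Scope complex_scope.

(** * Exponential tail bounds for independent rounds *)

Section Chernoff.
Variable R : realType.

(** By [1 - y <= expR (- y)] it suffices that (1 + y + 2 y^2)(1 - y) = 1 + y^2 (1 - 2 y) is at least
    1. *)
Lemma expR_le_quadratic (y : R) : y <= 1 / 2 -> expR y <= 1 + y + 2 * y ^+ 2.
Proof.
move=> y2; have y1 : 0 < 1 - y by lra.
have h : 1 - y <= expR (- y) by rewrite expR_ge1Dx.
have E0 := expR_gt0 (- y).
rewrite -[y in expR y]opprK expRN -[X in X <= _]div1r ler_pdivrMr //.
apply: (@le_trans _ _ ((1 + y + 2 * y ^+ 2) * (1 - y))).
  have : 0 <= y ^+ 2 * (1 - 2 * y) by rewrite mulr_ge0 ?sqr_ge0 //; lra.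
  have -> : (1 + y + 2 * y ^+ 2) * (1 - y) = 1 + y ^+ 2 * (1 - 2 * y) by ring.
  by lra.
rewrite ler_wpM2l //.
have -> : 1 + y + 2 * y ^+ 2 = (1 + 2 * y) ^+ 2 / 2 + (1 / 2 - y) by field.
by rewrite addr_ge0 ?subr_ge0 // divr_ge0 ?sqr_ge0.
Qed.

(** Expresses independence of the rounds; it gives both the total mass of the histories and the
    factorisation of the exponential moment. *)
Lemma sum_tuple_prod (A : comPzRingType) (S : finType) (T : nat) (g : S -> A) :
  \sum_(h : T.-tuple S) \prod_(t < T) g (tnth h t) = (\sum_s g s) ^+ T.
Proof.
have -> : (\sum_s g s) ^+ T = \prod_(t < T) \sum_s g s.
  by rewrite prodr_const card_ord.
rewrite bigA_distr_bigA /=.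
rewrite (reindex (fun f : {ffun 'I_T -> S} => [tuple f t | t < T])) /=.
  by apply: eq_bigr => f _; apply: eq_bigr => t _; rewrite tnth_mktuple.
exists (fun h : T.-tuple S => [ffun t => tnth h t]) => [f|h] _.
  by apply/ffunP => t; rewrite ffunE tnth_mktuple.
by apply: eq_from_tnth => t; rewrite tnth_mktuple ffunE.
Qed.

Lemma upper_tail (S : finType) (T : nat) (p f : S -> R) (D eps : R) :
  (forall s, 0 <= p s) -> \sum_s p s = 1 ->
  0 < D -> 0 < eps -> eps <= 1 ->
  (forall s, f s <= 2 * D) -> \sum_s p s * f s ^+ 2 <= 4 * D ->
  \sum_(h : T.-tuple S | T%:R * (\sum_s p s * f s + eps) < \sum_(t < T) f (tnth h t))
    \prod_(t < T) p (tnth h t) <= expR (- (T%:R * (eps ^+ 2 / (32 * D)))).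
Proof.
move=> p0 p1 D0 e0 e1 fD fV.
set mu := \sum_s p s * f s.
(* This value minimises the final exponent [8 * D * lam ^+ 2 - lam * eps] per round, with minimum
   [- eps ^+ 2 / (32 * D)]; as [eps <= 1], it also keeps [lam * f s] below 1/2. *)
pose lam := eps / (16 * D).
have lam0 : 0 < lam by rewrite divr_gt0 // mulr_gt0.
have lamf s : lam * f s <= 1 / 2.
  apply: (@le_trans _ _ (lam * (2 * D))); first by rewrite ler_wpM2l // ltW.
  have -> : lam * (2 * D) = eps / 8 by rewrite /lam; field; rewrite gt_eqF.
  by lra.
(* The quadratic bound on [expR] is applied to each outcome, and 1 + x <= e^x turns the resulting
   mean back into an exponential. *)
have mgf : \sum_s p s * expR (lam * f s) <= expR (lam * mu + 8 * D * lam ^+ 2).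
  apply: le_trans (expR_ge1Dx _).
  apply: (@le_trans _ _ (\sum_s (p s + lam * (p s * f s) + 2 * lam ^+ 2 * (p s * f s ^+ 2)))).
    apply: ler_sum => s _.
    have -> : p s + lam * (p s * f s) + 2 * lam ^+ 2 * (p s * f s ^+ 2)
       = p s * (1 + lam * f s + 2 * (lam * f s) ^+ 2) by ring.
    by rewrite ler_wpM2l // expR_le_quadratic.
  rewrite !big_split /= p1 -!mulr_sumr -/mu addrA lerD2l.
  have -> : 8 * D * lam ^+ 2 = 2 * lam ^+ 2 * (4 * D) by ring.
  by rewrite ler_wpM2l // mulr_ge0 // sqr_ge0.
(* Markov's inequality for [expR (lam * \sum_t f (tnth h t))] *)
apply: (@le_trans _ _ (\sum_(h : T.-tuple S) (\prod_(t < T) p (tnth h t)) *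
   expR (lam * (\sum_(t < T) f (tnth h t) - T%:R * (mu + eps))))).
  rewrite [X in X <= _]big_mkcond /=; apply: ler_sum => h _.
  have P0 : 0 <= \prod_(t < T) p (tnth h t) by rewrite prodr_ge0.
  case: ifP => [hs|_]; last by rewrite mulr_ge0 // expR_ge0.
  rewrite ler_peMr // -[X in X <= _]expR0 ler_expR mulr_ge0 ?(ltW lam0) // subr_ge0.
  exact: ltW hs.
have -> : \sum_(h : T.-tuple S) (\prod_(t < T) p (tnth h t)) *
   expR (lam * (\sum_(t < T) f (tnth h t) - T%:R * (mu + eps)))
   = (\sum_s p s * expR (lam * f s)) ^+ T * expR (- lam * (T%:R * (mu + eps))).
  rewrite -sum_tuple_prod mulr_suml; apply: eq_bigr => h _.
  rewrite [in RHS]big_split /= -[RHS]mulrA -expR_sum -mulr_sumr.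
  rewrite -expRD; congr (_ * expR _).
  by ring.
apply: (@le_trans _ _ (expR (lam * mu + 8 * D * lam ^+ 2) ^+ T * expR (- lam * (T%:R * (mu + eps))))).
  rewrite ler_wpM2r ?expR_ge0 // lerXn2r ?nnegrE ?expR_ge0 //.
  by rewrite sumr_ge0 // => s _; rewrite mulr_ge0 ?expR_ge0.
rewrite -expRM_natl -expRD ler_expR le_eqVlt; apply/orP; left; apply/eqP.
by rewrite /lam; field; rewrite gt_eqF.
Qed.

(** The upper tail bound is applied to [f] and to [- f], and the two are added. *)
Lemma two_sided_tail (S : finType) (T : nat) (p f : S -> R) (D eps : R) :
  (forall s, 0 <= p s) -> \sum_s p s = 1 ->
  0 < D -> 0 < eps -> eps <= 1 -> (0 < T)%N ->
  (forall s, `|f s| <= 2 * D) -> \sum_s p s * f s ^+ 2 <= 4 * D ->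
  \sum_(h : T.-tuple S |
      eps < `|(\sum_(t < T) f (tnth h t)) / T%:R - \sum_s p s * f s|)
    \prod_(t < T) p (tnth h t) <= 2 * expR (- (T%:R * (eps ^+ 2 / (32 * D)))).
Proof.
move=> p0 p1 D0 e0 e1 T0 fD fV.
have TR : 0 < T%:R :> R by rewrite ltr0n.
pose g s := - f s.
have Up := @upper_tail S T p f D eps p0 p1 D0 e0 e1 (fun s => le_trans (ler_norm _) (fD s)) fV.
have gD s : g s <= 2 * D by apply: le_trans (ler_norm _) _; rewrite normrN.
have gV : \sum_s p s * g s ^+ 2 <= 4 * D.
  by under eq_bigr do rewrite sqrrN.
have Lo := @upper_tail S T p g D eps p0 p1 D0 e0 e1 gD gV.
rewrite mulr_natl mulr2n; apply: le_trans (lerD Up Lo).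
rewrite !(big_mkcond (fun h : T.-tuple S => _ < _)) /= -big_split /=.
apply: ler_sum => h _.
have P0 : 0 <= \prod_(t < T) p (tnth h t) by rewrite prodr_ge0.
have -> : \sum_s p s * g s = - \sum_s p s * f s.
  by rewrite -sumrN; apply: eq_bigr => s _; rewrite mulrN.
have -> : \sum_(t < T) g (tnth h t) = - \sum_(t < T) f (tnth h t) by rewrite sumrN.
set X := \sum_(t < T) _; set mu := \sum_s _.
have -> : X / T%:R - mu = (X - T%:R * mu) / T%:R by field; rewrite gt_eqF.
rewrite normrM (ger0_norm (_ : 0 <= T%:R^-1)) ?invr_ge0 ?ler0n //.
rewrite ltr_pdivlMr // lter_normr.
case: ifP => [/orP[] hX|_].
- by rewrite ifT ?lerDl; [case: ifP|lra].
- by rewrite addrC ifT ?lerDl; [case: ifP|lra].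
- by rewrite addr_ge0 //; case: ifP.
Qed.

End Chernoff.

(** * From a fixed measurement with unbiased estimators to a learner *)

Lemma normc_real (R : rcfType) (a : R) : `|a%:C| = `|a|%:C.
Proof. by rewrite normc_def /= expr0n addr0 sqrtr_sqr. Qed.

(** Moves the complex-valued outcome traces to a real distribution, to which the tail bounds
    apply. *)
Lemma outcome_prob (R : realType) n (S : finType) (F : S -> 'M[R[i]]_(2 ^ n)) rho :
  is_povm F -> qstate rho ->
  exists p : S -> R, [/\ forall s, 0 <= p s, \sum_s p s = 1 &
    forall s, \tr (F s *m rho) = (p s)%:C].
Proof.
move=> [Fp F1] [rp r1].
have tr0 s : 0 <= \tr (F s *m rho) by exact: psd_mxtrace_mul_ge0.
have trE s : \tr (F s *m rho) = (complex.Re (\tr (F s *m rho)))%:C.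
  by rewrite RRe_real // ger0_real.
exists (fun s => complex.Re (\tr (F s *m rho))); split=> //.
- by move=> s; rewrite -ler0c -trE.
apply: complexI; rewrite rmorph_sum /=; under eq_bigr do rewrite -trE.
by rewrite -raddf_sum /= -mulmx_suml F1 mul1mx r1.
Qed.

(** Since 288 = 9 * 32, the exponential is at most (M+1)^-9, so the left side is at most 2 / (M+1)^8
    <= 2 / 256. *)
Lemma copies_bound (R : realType) (M T : nat) (D eps : R) : (0 < M)%N -> 0 < D -> 0 < eps ->
  288 * (D * ln M.+1%:R) / eps ^+ 2 <= T%:R ->
  M%:R * (2 * expR (- (T%:R * (eps ^+ 2 / (32 * D))))) <= 1 / 100.
Proof.
move=> M0 D0 e0 hT.
have M1 : 2 <= M.+1%:R :> R by rewrite ler_nat.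
have MR : M%:R <= M.+1%:R :> R by rewrite ler_nat.
move: (M.+1%:R) M1 MR hT => m M1 MR hT.
have mpos : 0 < m by lra.
have : expR (- (T%:R * (eps ^+ 2 / (32 * D)))) <= m ^- 9.
  rewrite -{1}[m]lnK ?posrE // -expRM_natl -expRN ler_expR lerN2.
  apply: (@le_trans _ _ (288 * (D * ln m) / eps ^+ 2 * (eps ^+ 2 / (32 * D)))).
    rewrite le_eqVlt; apply/orP; left; apply/eqP.
    by field; rewrite !gt_eqF.
  by rewrite ler_wpM2r // divr_ge0 ?sqr_ge0 // mulr_ge0 // ltW.
move=> h; apply: (@le_trans _ _ (m * (2 * m ^- 9))).
  by rewrite ler_pM // ?ler_wpM2l // mulr_ge0 // expR_ge0.
have -> : m * (2 * m ^- 9) = 2 / m ^+ 8 by field; rewrite gt_eqF.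
rewrite ler_pdivrMr ?exprn_gt0 //.
have : 2 ^+ 8 <= m ^+ 8 by rewrite lerXn2r ?nnegrE //; lra.
have -> : 2 ^+ 8 = 256 :> R by ring.
by lra.
Qed.

(** With x = M + 1 this keeps the logarithm away from zero even for M = 1, so that rounding up the
    number of copies can be absorbed. *)
Lemma half_le_ln (R : realType) (x : R) : 2 <= x -> 1 / 2 <= ln x.
Proof.
move=> x2; rewrite -[X in X <= _]expRK ler_ln ?posrE ?expR_gt0 //; last by lra.
apply: le_trans x2.
rewrite -[1 / 2]opprK expRN invf_ple ?posrE ?expR_gt0 //.
by apply: le_trans (expR_ge1Dx _); lra.
Qed.

Lemma empirical_mean_learner (R : realType) n M (O : 'I_M -> 'M[R[i]]_(2 ^ n))
    (eps D : R) (S : finType) (F : S -> 'M[R[i]]_(2 ^ n)) (f : 'I_M -> S -> R) :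
  is_povm F -> (0 < M)%N -> 0 < eps -> eps <= 1 -> 1 <= D ->
  (forall x, \sum_s (f x s)%:C *: F s = O x) ->
  (forall x s, `|f x s| <= 2 * D) ->
  (forall x rho, qstate rho ->
     \sum_s (f x s ^+ 2)%:C * \tr (F s *m rho) <= (4 * D)%:C) ->
  exists L : nomem_learner R n M,
    (lT L)%:R <= 290 * (D * ln M.+1%:R) / eps ^+ 2 /\
    forall rho, qstate rho -> (99 / 100)%:C <= success_prob L O eps rho.
Proof.
move=> FP M0 e0 e1 D1 fO fD fV.
have D0 : 0 < D by lra.
have M1 : 2 <= M.+1%:R :> R by rewrite ler_nat.
pose a := 288 * (D * ln M.+1%:R) / eps ^+ 2.
have ln2 := half_le_ln _ _ M1.
have e20 : 0 < eps ^+ 2 by rewrite exprn_gt0.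
have a0 : 0 <= a by rewrite divr_ge0 ?mulr_ge0 //; lra.
(* Then a < T <= a + 1. The extra copy costs at most [2 * (D * ln M.+1%:R) / eps ^+ 2], which is at
   least 1; hence 290 = 288 + 2. *)
pose T := (Num.truncn a).+1.
have /andP[Tle ltT] := truncn_itv a0.
exists (@NoMemLearner R n M T S (fun _ => F)
  (fun h x => (\sum_(t < T) f x (tnth h t)) / T%:R) (fun _ => FP)); split=> /=.
  rewrite /T -natr1; apply: (@le_trans _ _ (a + 1)); first by rewrite lerD2r.
  have -> : 290 * (D * ln M.+1%:R) / eps ^+ 2 = a + 2 * (D * ln M.+1%:R) / eps ^+ 2.
    by rewrite /a; field; rewrite gt_eqF.
  rewrite lerD2l ler_pdivlMr // mul1r.
  have : eps ^+ 2 <= 1 by apply: exprn_ile1 => //; exact: ltW.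
  have : 1 * (1 / 2) <= D * ln M.+1%:R by apply: ler_pM => //; lra.
  by lra.
move=> rho rhoP; have [p [p0 p1 pE]] := outcome_prob _ _ _ _ _ FP rhoP.
have trO x : \tr (O x *m rho) = (\sum_s p s * f x s)%:C.
  rewrite -fO mulmx_suml raddf_sum rmorph_sum /=; apply: eq_bigr => s _.
  by rewrite -scalemxAl mxtraceZ pE -rmorphM mulrC.
have var x : \sum_s p s * f x s ^+ 2 <= 4 * D.
  have := fV x rho rhoP; rewrite (_ : \sum_s _ = (\sum_s p s * f x s ^+ 2)%:C) ?lecR //.
  by rewrite rmorph_sum /=; apply: eq_bigr => s _; rewrite pE -rmorphM mulrC.
pose P (h : T.-tuple S) := \prod_(t < T) p (tnth h t).
have P0 h : 0 <= P h by rewrite prodr_ge0.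
pose est (h : T.-tuple S) x := (\sum_(t < T) f x (tnth h t)) / T%:R.
pose bad (h : T.-tuple S) x := eps < `|est h x - \sum_s p s * f x s|.
rewrite /success_prob /hist_prob /=.
(* The success probability is rewritten as the real mass of the histories in which no estimate is
   bad. *)
have -> : \sum_(h : T.-tuple S) (\prod_(t < T) \tr (F (tnth h t) *m rho)) *
    (if all_within O rho eps (est h) then 1 else 0) =
    (\sum_(h : T.-tuple S) P h * ([forall x, ~~ bad h x])%:R)%:C.
  rewrite rmorph_sum /=; apply: eq_bigr => h _; rewrite rmorphM /=; congr (_ * _).
    by rewrite rmorph_prod /=; apply: eq_bigr => t _; rewrite pE.
  have -> : all_within O rho eps (est h) = [forall x, ~~ bad h x].
    apply: eq_forallb => x.
    by rewrite trO -rmorphB normc_real lecR /bad -leNgt.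
  by case: [forall x, _]; rewrite ?rmorph1 ?rmorph0.
rewrite lecR.
have tot : \sum_(h : T.-tuple S) P h = 1 by rewrite sum_tuple_prod p1 expr1n.
have badP : \sum_x \sum_(h : T.-tuple S | bad h x) P h <= 1 / 100.
  apply: le_trans (copies_bound _ _ _ _ _ M0 D0 e0 (ltW ltT)).
  apply: (@le_trans _ _ (\sum_(x < M) (2 * expR (- (T%:R * (eps ^+ 2 / (32 * D))))))).
    by apply: ler_sum => x _; apply: two_sided_tail.
  by rewrite sumr_const card_ord -[X in X <= _]mulr_natl.
(* Union bound: a history outside the good event is counted for at least one bad [x]. *)
have union : \sum_(h : T.-tuple S) P h <=
    \sum_(h : T.-tuple S) P h * ([forall x, ~~ bad h x])%:R +
    \sum_x \sum_(h : T.-tuple S | bad h x) P h.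
  under [X in _ <= _ + X]eq_bigr do rewrite big_mkcond.
  rewrite exchange_big /= -big_split /=; apply: ler_sum => h _.
  case: (boolP [forall x, _]) => [_|/forallPn[x]].
    by rewrite mulr1 lerDl sumr_ge0 // => x _; case: ifP.
  rewrite negbK => bx; rewrite mulr0 add0r (bigD1 x) //= bx lerDl.
  by rewrite sumr_ge0 // => y _; case: ifP.
lra.
Qed.

(** Both 1 + A and 1 - A pair nonnegatively with [rho]; this makes the trace real and bounds it on
    both sides. *)
Lemma norm_expect_le1 (C : numClosedFieldType) n (A rho : 'M[C]_n) :
  is_hermitian A -> opnorm_le1 A -> psd rho -> \tr rho = 1 -> `|\tr (A *m rho)| <= 1.
Proof.
move=> hA oA rp r1.
have P s : s \is Num.real -> s ^+ 2 = 1 -> 0 <= 1 + s * \tr (A *m rho).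
  move=> sR s2; have := psd_mxtrace_mul_ge0 _ _ _ _ (opnorm_le1_psd _ _ _ _ hA oA sR s2) rp.
  by rewrite mulmxDl mul1mx -scalemxAl mxtraceD mxtraceZ r1.
have Pp : 0 <= 1 + \tr (A *m rho) by have := P 1 (rpred1 _) (expr1n _ _); rewrite mul1r.
have Pn : 0 <= 1 - \tr (A *m rho).
  by have := P (-1) (rpredN1 _) (sqrr_sign _ 1); rewrite mulN1r.
have tR : \tr (A *m rho) \is Num.real.
  by rewrite -[X in X \is _](addKr 1) rpredD ?rpredN ?rpred1 // ger0_real.
rewrite real_ler_norml //; apply/andP; split; last by rewrite -subr_ge0.
by rewrite -subr_ge0 opprK addrC.
Qed.

Lemma zero_copy_learner (R : realType) n M (O : 'I_M -> 'M[R[i]]_(2 ^ n)) (eps : R) :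
  (forall x rho, qstate rho -> `|\tr (O x *m rho)| <= eps%:C) ->
  exists L : nomem_learner R n M, lT L = 0%N /\
    forall rho, qstate rho -> (99 / 100)%:C <= success_prob L O eps rho.
Proof.
move=> small.
have povm1 : is_povm (fun _ : unit => 1%:M : 'M[R[i]]_(2 ^ n)).
  split=> [_|]; last by rewrite sumr_const card_unit.
  split; first exact: adjmx1.
  by move=> v; rewrite mulmx1 adjmx_mul_ge0.
(* With no rounds the only history is the empty one, of probability 1, and all estimates are 0. *)
exists (@NoMemLearner R n M 0 unit (fun _ _ => 1%:M) (fun _ _ => 0) (fun _ => povm1)).
split=> // rho rhoP; rewrite /success_prob /hist_prob /=.
rewrite (eq_bigr (fun=> 1)) => [|h _]; last first.
  rewrite big_ord0 mul1r ifT //; apply/forallP => x.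
  by rewrite rmorph0 sub0r normrN small.
by rewrite sumr_const card_tuple expn0 -(rmorph1 (real_complex R)) lecR; lra.
Qed.

(** * Measuring one randomly chosen observable *)

Section TwoOutcome.
Variables (R : realType) (n M : nat) (O : 'I_M -> 'M[R[i]]_(2 ^ n)).
Hypothesis OP : forall x, is_hermitian (O x) /\ opnorm_le1 (O x).
Hypothesis M_gt0 : (0 < M)%N.

(** The random choice of an observable is absorbed into the factor 1/M; the outcome [true] stands
    for the sign -1. *)
Definition two_outcome_povm (s : 'I_M * bool) : 'M[R[i]]_(2 ^ n) :=
  (2 * M%:R)^-1 *: (1%:M + (-1) ^+ s.2 *: O s.1).

Definition two_outcome_est (x : 'I_M) (s : 'I_M * bool) : R :=
  if s.1 == x then M%:R * (-1) ^+ s.2 else 0.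

Let MC : M%:R != 0 :> R[i]. Proof. by rewrite pnatr_eq0 -lt0n. Qed.

Lemma two_outcome_povmP : is_povm two_outcome_povm.
Proof.
split=> [[x b]|].
  apply: psdZ; first by rewrite invr_ge0 mulr_ge0.
  have [hO oO] := OP x; apply: opnorm_le1_psd => //.
    by rewrite rpredX // rpredN1.
  by rewrite /= sqrr_sign.
rewrite -(pair_bigA _ (fun x b => two_outcome_povm (x, b))) /=.
rewrite (eq_bigr (fun=> M%:R^-1 *: 1%:M)) => [|x _].
  by rewrite sumr_const card_ord -scaler_nat scalerA divff // scale1r.
rewrite big_bool /two_outcome_povm /= -scalerDr expr1 expr0 scaleN1r scale1r.
rewrite addrACA addNr addr0 -mulr2n -[1%:M *+ 2]scaler_nat scalerA; congr (_ *: _).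
by field.
Qed.

Lemma two_outcome_unbiased x :
  \sum_s (two_outcome_est x s)%:C *: two_outcome_povm s = O x.
Proof.
rewrite -(pair_bigA _ (fun y b => (two_outcome_est x (y, b))%:C *: two_outcome_povm (y, b))) /=.
rewrite (bigD1 x) //= [X in _ + X]big1 ?addr0 => [|y yx]; last first.
  by apply: big1 => b _; rewrite /two_outcome_est /= (negbTE yx) rmorph0 scale0r.
rewrite big_bool /two_outcome_est /two_outcome_povm /= eqxx expr1 expr0.
rewrite !rmorphM /= !rmorph_nat rmorphN1 rmorph1.
by apply/matrixP => i j; rewrite !mxE; field.
Qed.

Lemma two_outcome_bound x s : `|two_outcome_est x s| <= 2 * M%:R.
Proof.
rewrite /two_outcome_est; case: ifP => _; last by rewrite normr0 mulr_ge0.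
by rewrite normrM normrX normrN1 expr1n mulr1 normr_nat ler_peMl // ler1n.
Qed.

Lemma two_outcome_variance x rho : qstate rho ->
  \sum_s (two_outcome_est x s ^+ 2)%:C * \tr (two_outcome_povm s *m rho) <= (4 * M%:R)%:C.
Proof.
move=> [rp r1].
rewrite -(pair_bigA _ (fun y b => (two_outcome_est x (y, b) ^+ 2)%:C * \tr (two_outcome_povm (y, b) *m rho))) /=.
rewrite (bigD1 x) //= [X in _ + X]big1 ?addr0 => [|y yx]; last first.
  apply: big1 => b _.
  by rewrite /two_outcome_est /= (negbTE yx) expr0n rmorph0 mul0r.
rewrite big_bool /two_outcome_est /two_outcome_povm /= eqxx expr1 expr0.
rewrite !exprMn sqrrN expr1n mulr1 -mulrDr -mxtraceD -mulmxDl -scalerDr.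
rewrite scaleN1r scale1r addrACA addNr addr0 -scalemxAl mulmxDl mul1mx mxtraceZ mxtraceD r1.
rewrite !rmorphM /= !rmorph_nat.
(* The two outcomes belonging to [x] have total probability 1/M, and the estimator squares to M^2 on
   both. *)
have -> : M%:R ^+ 2 * ((2 * M%:R)^-1 * (1 + 1)) = M%:R :> R[i] by field.
by rewrite ler_peMl // ler1n.
Qed.

End TwoOutcome.

(** * The real estimator for the pair measurement *)

Section PairEstimator.
Variables (R : realType) (d : nat) (A : 'M[R[i]]_d).
Hypotheses (hA : is_hermitian A) (oA : opnorm_le1 A) (d_gt0 : (0 < d)%N).

Definition pair_est (s : 'I_d * 'I_d * 'I_4) : R :=
  d%:R * (2 * complex.Re (A s.1.1 s.1.2 * ('i%R : R[i]) ^+ s.2)).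

(** Writing 2 Re z as z + z^* and using hermiticity for the conjugate entry gives the coefficients
    of [pair_povm_unbiased]. *)
Lemma pair_estE k l a : (pair_est (k, l, a))%:C =
  d%:R * (A k l * 'i%R ^+ nat_of_ord a + A l k * Num.conj ('i%R ^+ nat_of_ord a)).
Proof.
rewrite /pair_est !rmorphM /= !rmorph_nat (hermitian_entry _ _ _ k l hA) -rmorphM.
by rewrite complexRe [X in 2 * X]ReE; field.
Qed.

Lemma pair_est_norm k l a : `|(pair_est (k, l, a))%:C| <= 2 * d%:R * `|A k l|.
Proof.
rewrite pair_estE normrM normr_nat.
have -> : 2 * d%:R * `|A k l| = d%:R * (`|A k l| + `|A l k|).
  by rewrite (hermitian_entry _ _ _ k l hA) norm_conjC; ring.
rewrite ler_wpM2l //; apply: le_trans (ler_normD _ _) _.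
by rewrite !normrM norm_conjC normrX normCi expr1n !mulr1.
Qed.

Lemma pair_est_bound s : `|pair_est s| <= 2 * d%:R.
Proof.
case: s => -[k l] a; rewrite -lecR -normc_real; apply: le_trans (pair_est_norm _ _ _) _.
rewrite rmorphM /= !rmorph_nat ler_piMr ?mulr_ge0 //.
(* A single entry has modulus at most 1, its square being one term of a column sum. *)
rewrite -(@expr_le1 _ 2) //; apply: le_trans (opnorm_le1_col _ _ _ l oA).
by rewrite (bigD1 k) //= lerDl sumr_ge0 // => j _; rewrite exprn_ge0.
Qed.

Lemma pair_est_unbiased : \sum_s (pair_est s)%:C *: pair_povm _ _ s = A.
Proof.
rewrite pair_sum -[RHS](pair_povm_unbiased _ _ d_gt0).
apply: eq_bigr => k _; apply: eq_bigr => l _; apply: eq_bigr => a _.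
by rewrite pair_estE.
Qed.

Lemma pair_est_variance rho : psd rho -> \tr rho = 1 ->
  \sum_s (pair_est s ^+ 2)%:C * \tr (pair_povm _ _ s *m rho) <= (4 * d%:R)%:C.
Proof.
move=> rp r1; rewrite rmorphM /= !rmorph_nat.
apply: le_trans (pair_povm_moment _ _ d_gt0 _ _ hA oA rp r1); rewrite pair_sum.
apply: ler_sum => k _; apply: ler_sum => l _; apply: ler_sum => a _.
rewrite ler_wpM2r ?psd_mxtrace_mul_ge0 ?pair_povm_psd //; first exact: pair_povm_psd.
rewrite -[pair_est _ ^+ 2]ger0_norm ?sqr_ge0 // -normc_real rmorphXn /= normrX.
by rewrite lerXn2r ?nnegrE ?mulr_ge0 ?pair_est_norm.
Qed.

End PairEstimator.

Theorem mainTheorem6 (R : realType) :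
  exists c : R, 0 < c /\
  forall (n M : nat) (O : 'I_M -> 'M[R[i]]_(2 ^ n)) (eps : R),
    (forall x : 'I_M, is_hermitian (O x) /\ opnorm_le1 (O x)) ->
    0 < eps ->
    exists L : nomem_learner R n M,
      ((lT L)%:R <= c * Num.min (M%:R * ln (M.+1)%:R)
                               ((2 ^+ n) * ln (M.+1)%:R) / eps ^+ 2)%R /\
      forall rho : 'M[R[i]]_(2 ^ n), qstate rho ->
        ((99%:R / 100%:R)%:C <= success_prob L O eps rho)%R.
Proof.
(* The constant comes from [empirical_mean_learner]. *)
exists 290; split=> // n M O eps OP e0.
have l0 : 0 <= ln (M.+1%:R : R) by rewrite ln_ge0 // ler1n.
(* Without observables there is nothing to estimate, and for [eps >= 1] the estimate 0 is accurate
   enough; otherwise M >= 1 and [eps <= 1], as the tail bounds require. *)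
have [small|] := boolP ((M == 0%N) || (1 <= eps)).
  have [x rho [rp r1]|L [LT LP]] := @zero_copy_learner R n M O eps.
    case/orP: small => [/eqP M0|e1]; first by have := leq_ltn_trans (leq0n x) (ltn_ord x); rewrite M0.
    have [hO oO] := OP x; apply: le_trans (norm_expect_le1 _ _ _ _ hO oO rp r1) _.
    by rewrite -(rmorph1 (real_complex R)) lecR.
  exists L; split=> //; rewrite LT divr_ge0 ?sqr_ge0 // mulr_ge0 //.
  by rewrite le_min !mulr_ge0 // exprn_ge0.
rewrite negb_or -lt0n -ltNge => /andP[M0 /ltW e1].
have d0 : (0 < 2 ^ n)%N by rewrite expn_gt0.
(* The smaller term of the minimum decides which of the two measurements is used. *)
rewrite -natrX; case: leP => _.
- apply: (@empirical_mean_learner _ _ _ _ _ M%:R _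
    (@two_outcome_povm R n M O) (@two_outcome_est R M)) => //.
  + exact: two_outcome_povmP.
  + by rewrite ler1n.
  + exact: two_outcome_unbiased.
  + exact: two_outcome_bound.
  + by move=> x rho; apply: two_outcome_variance.
- apply: (@empirical_mean_learner _ _ _ _ _ (2 ^ n)%:R _
    (@pair_povm R[i] (2 ^ n)) (fun x => @pair_est R (2 ^ n) (O x))) => //.
  + by split; [exact: pair_povm_psd | exact: pair_povm_sum].
  + by rewrite ler1n.
  + by move=> x; have [hO oO] := OP x; apply: pair_est_unbiased.
  + by move=> x; have [hO oO] := OP x; apply: pair_est_bound.
  + by move=> x rho [rp r1]; have [hO oO] := OP x; apply: pair_est_variance.
Qed.
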